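(* Let $r=\{x\mid x\notin x\}$ and $L\equiv r\notin r$. Then $\Vdash L$, $\Vdash\neg L$, $\Vdash\mathcal T\ulcorner L\urcorner$, $\Vdash\mathcal T\ulcorner\neg L\urcorner$, $\Vdash\neg\mathcal T\ulcorner\neg L\urcorner$ and $\Vdash\neg\mathcal T\ulcorner L\urcorner$.
   Context: The language of the librationist theory £: variables; primitive set constants $\mathcal T$ (truth set) and $\mathcal F$; atomic formulas $a\in b$; formulas $\downarrow AB$ (joint denial), $\forall vA$; terms $\{v\mid A\}$; name terms $\ulcorner X\urcorner$. $\neg A:=\downarrow AA$, $a\notin b:=\neg a\in b$, other connectives and $\exists$ classical; $\mathcal T\ulcorner A\urcorner$ is the formula $\ulcorner A\urcorner\in\mathcal T$. Semantics: for each $n\in\omega$ and ordinal $\alpha$ a full set $\models^\alpha_n$ of formulas ($\downarrow AB$ in it iff neither $A$ nor $B$; $\forall vA$ in it iff all substitution instances $A^b_v$ are); $(\models^0_n)_n$ a fixed enumeration of full sets; for $\alpha>0$, $\mathcal T\ulcorner A\urcorner\in\models^\alpha_n$ iff for some $\gamma<\alpha$, $A\in\models^\delta_n$ for all $\gamma\le\delta<\alpha$, and $a\in\{x\mid A\}\in\models^\alpha_n$ iff $\mathcal T\ulcorner A^a_x\urcorner\in\models^\alpha_n$. $\models^\alpha B$ iff $B\in\models^\alpha_n$ for all $n$. $\mathrm{IN}^\alpha(A)$ iff $\models^\beta\mathcal T\ulcorner A\urcorner$ for all $\beta\ge\alpha$; $\mathrm{IN}(A)$ iff $\exists\alpha\,\mathrm{IN}^\alpha(A)$;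 $\alpha$ stabilizes $A$ iff ($\mathrm{IN}(A)\Rightarrow\mathrm{IN}^\alpha(A)$) and ($\models^\alpha\mathcal T\ulcorner A\urcorner\Rightarrow\mathrm{IN}(A)$); $\varpi$ is the least ordinal stabilizing every sentence. $\Vdash A$ ($A$ is a thesis) iff $\neg\mathcal T\ulcorner\neg A\urcorner\in\models^\varpi_n$ for all $n$.
   Formalization: The formal theorem adds the assumption that ϖ > 0; for some initial enumerations of full sets (late stages of another process) the least stabilizing ordinal is 0 and L fails to be a thesis. *)

(* Defs.v *)
From mathcomp Require Import all_boot.

Set Implicit Arguments.
Unset Strict Implicit.
Unset Printing Implicit Defensive.

(* Variables are natural numbers.  [TruthC] and [FC] are the two primitive set
   constants; [NameF A] and [NameT t] are the name terms of a formula and of a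
   term. *)
Inductive term : Set :=
  | Var of nat
  | TruthC
  | FC
  | Compr of nat & formula
  | NameF of formula
  | NameT of term
with formula : Set :=
  | Mem of term & term
  | Nor of formula & formula
  | All of nat & formula.

Definition Neg (A : formula) : formula := Nor A A.
Definition NotMem (a b : term) : formula := Neg (Mem a b).
Definition Tr (A : formula) : formula := Mem (NameF A) TruthC.

(* Name terms are closed: a variable occurring in X is not free in the name of
   X, and substitution leaves names untouched. *)
Fixpoint free_t (v : nat) (t : term) : bool :=
  match t with
  | Var w => w == v
  | Compr w A => (w != v) && free_f v A
  | TruthC | FC | NameF _ | NameT _ => false
  end
with free_f (v : nat) (A : formula) : bool :=
  match A with
  | Mem a b => free_t v a || free_t v b
  | Nor A B => free_f v A || free_f v B
  | All w A => (w != v) && free_f v A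
  end.

Definition sentence (A : formula) : Prop := forall v, ~~ free_f v A.

(* [subst_f v b A] replaces the free occurrences of v by b without renaming;
   it is only used when b is free for v in A. *)
Fixpoint subst_t (v : nat) (b : term) (t : term) : term :=
  match t with
  | Var w => if w == v then b else Var w
  | Compr w A => if w == v then Compr w A else Compr w (subst_f v b A)
  | TruthC | FC | NameF _ | NameT _ => t
  end
with subst_f (v : nat) (b : term) (A : formula) : formula :=
  match A with
  | Mem a c => Mem (subst_t v b a) (subst_t v b c)
  | Nor A B => Nor (subst_f v b A) (subst_f v b B)
  | All w A => if w == v then All w A else All w (subst_f v b A)
  end.

Fixpoint free_for_t (b : term) (v : nat) (t : term) : bool :=
  match t with
  | Compr w A => ~~ free_t v t || ~~ free_t w b && free_for_f b v A
  | Var _ | TruthC | FC | NameF _ | NameT _ => true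
  end
with free_for_f (b : term) (v : nat) (A : formula) : bool :=
  match A with
  | Mem a c => free_for_t b v a && free_for_t b v c
  | Nor A B => free_for_f b v A && free_for_f b v B
  | All w B => ~~ free_f v A || ~~ free_t w b && free_for_f b v B
  end.

(* [osup f] denotes the least ordinal strictly above every f i.  Since K ranges
   over a universe, these are the ordinals of a proper class; two trees denote
   the same ordinal when each is [ole] the other. *)
Inductive Ord : Type := osup (K : Type) (f : K -> Ord).

Fixpoint ole (a b : Ord) {struct a} : Prop :=
  match a, b with
  | osup K f, osup J g => forall i : K, exists j : J, ole (f i) (g j)
  end.

Definition olt (a b : Ord) : Prop :=
  match b with osup J g => exists j : J, ole a (g j) end.

Definition ozero : Ord := osup (fun e : Empty_set => match e with end).

Definition full (X : formula -> Prop) : Prop :=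
  (forall A B, X (Nor A B) <-> ~ X A /\ ~ X B) /\
  (forall v A, X (All v A) <->
     forall b, free_for_f b v A -> X (subst_f v b A)).

Definition stages := Ord -> nat -> formula -> Prop.

(* [sat al n] is the set of formulas indexed by the ordinal al and by n.  The
   family [sat ozero] is an arbitrary sequence of full sets, and at every stage
   the atoms not governed by the two clauses below are left unconstrained.
   [sat_ext] says that [sat] depends only on the ordinal a tree denotes. *)
Record librationist (sat : stages) : Prop := {
  sat_ext : forall al be n A, ole al be -> ole be al ->
    sat al n A -> sat be n A;
  sat_full : forall al n, full (sat al n);
  sat_Tr : forall al n A, olt ozero al ->
    (sat al n (Tr A) <->
     exists ga, olt ga al /\
       forall de, ole ga de -> olt de al -> sat de n A);
  sat_Compr : forall al n a x A, olt ozero al -> free_for_f a x A ->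
    (sat al n (Mem a (Compr x A)) <-> sat al n (Tr (subst_f x a A)))
}.

Definition valid (sat : stages) (al : Ord) (B : formula) : Prop :=
  forall n, sat al n B.

Definition INat (sat : stages) (al : Ord) (A : formula) : Prop :=
  forall be, ole al be -> valid sat be (Tr A).

Definition IN (sat : stages) (A : formula) : Prop := exists al, INat sat al A.

Definition stabilizes (sat : stages) (al : Ord) (A : formula) : Prop :=
  (IN sat A -> INat sat al A) /\ (valid sat al (Tr A) -> IN sat A).

Definition stabilizes_all (sat : stages) (al : Ord) : Prop :=
  forall A, sentence A -> stabilizes sat al A.

(* The least such ordinal is 0 for some sequences [sat ozero] (e.g. when these
   are themselves late stages of another process, chosen so that the sentences
   valid at 0 are exactly the [IN] ones); otherwise it is a limit ordinal. *)
Definition is_varpi (sat : stages) (varpi : Ord) : Prop :=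
  stabilizes_all sat varpi /\ (forall al, stabilizes_all sat al -> ole varpi al).

Definition thesis (sat : stages) (varpi : Ord) (A : formula) : Prop :=
  forall n, sat varpi n (Neg (Tr (Neg A))).

(* Main.v *)
Require Import Defs.
From mathcomp Require Import all_boot.
From Stdlib Require Import Classical.

Set Implicit Arguments.
Unset Strict Implicit.
Unset Printing Implicit Defensive.

(** At every positive stage, L holds iff Tr L fails, while Tr A holds at a
    successor stage iff A holds at the preceding one.  Hence L changes its truth
    value at every successor step, so that below a limit stage both L and Neg L
    hold cofinally often; a formula that holds cofinally often below a limit
    stage is not eventually false there.  It remains to see that varpi is a
    limit.  If it were the successor of some be then, A being in [IN] iff Tr A
    is, be would stabilize every sentence already, against minimality. *)

Lemma ole_refl (a : Ord) : ole a a.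
Proof. by elim: a => K f IH i; exists i; apply: IH. Qed.

Lemma ole_trans (b a c : Ord) : ole a b -> ole b c -> ole a c.
Proof.
elim: a b c => K f IH [J g] [M h] /= ab bc i.
have [j fg] := ab i; have [m gh] := bc j.
by exists m; apply: IH gh.
Qed.

Lemma ole_olt_trans (b a c : Ord) : ole a b -> olt b c -> olt a c.
Proof. by case: c => M h ab [m bh]; exists m; apply: ole_trans bh. Qed.

Lemma olt_ole_trans (b a c : Ord) : olt a b -> ole b c -> olt a c.
Proof.
case: b c => J g [M h] [j ag] bc; have [m gh] := bc j.
by exists m; apply: ole_trans gh.
Qed.

Lemma olt_ole (a b : Ord) : olt a b -> ole a b.
Proof.
elim: a b => K f IH [J g] [j ag] i; exists j; apply: IH.
by apply: olt_ole_trans ag; exists i; apply: ole_refl.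
Qed.

Lemma olt_irrefl (a : Ord) : ~ olt a a.
Proof.
elim: a => K f IH [i fi]; apply: (IH i).
by apply: olt_ole_trans fi; exists i; apply: ole_refl.
Qed.

(** Classical: if some [f i] had no [g j] above it, the induction hypothesis would put every [g j]
    strictly below [f i], so that [f i] would bound [osup g]. *)
Lemma ole_or_olt (a b : Ord) : ole a b \/ olt b a.
Proof.
elim: a b => K f IH [J g].
case: (classic (exists i, ole (osup g) (f i))) => [|nle]; first by right.
left=> i; apply: NNPP => ngt; apply: nle; exists i.
case fiE: (f i) => [M h] j.
have [fg|] := IH i (g j); first by case: ngt; exists j.
by rewrite fiE.
Qed.

Lemma ozero_ole (a : Ord) : ole ozero a.
Proof. by case: a => K f []. Qed.

Definition osucc (a : Ord) : Ord := osup (fun _ : unit => a).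

Lemma olt_osucc (a : Ord) : olt a (osucc a).
Proof. by exists tt; apply: ole_refl. Qed.

Lemma ole_osucc (a : Ord) : ole a (osucc a).
Proof. exact/olt_ole/olt_osucc. Qed.

Lemma olt_osuccE (a b : Ord) : olt a (osucc b) <-> ole a b.
Proof. by split=> [[]|ab] //; exists tt. Qed.

Lemma osucc_ole (a b : Ord) : olt a b -> ole (osucc a) b.
Proof. by case: b => J g [j ag] []; exists j. Qed.

Lemma osucc_gt0 (a : Ord) : olt ozero (osucc a).
Proof. by apply/olt_osuccE/ozero_ole. Qed.

Section Stages.

Variables (sat : stages) (Hsat : librationist sat).

Lemma sat_Neg al n A : sat al n (Neg A) <-> ~ sat al n A.
Proof.
by have [nor _] := sat_full Hsat al n; rewrite /Neg nor; split=> [[]|].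
Qed.

(** Below [osucc al] the stage [al] is the last one, so eventual truth there is truth at [al]. *)
Lemma sat_Tr_osucc al n A : sat (osucc al) n (Tr A) <-> sat al n A.
Proof.
rewrite (sat_Tr Hsat); last exact: osucc_gt0.
split=> [[ga [/olt_osuccE le_ga]]|satA]; first apply=> //.
  exact: olt_osucc.
exists al; split=> [|de le_al /olt_osuccE le_de]; first exact: olt_osucc.
exact: sat_ext satA.
Qed.

Lemma INat_valid al be A : INat sat al A -> ole al be -> valid sat be A.
Proof.
move=> inA le_be n; apply/sat_Tr_osucc/inA.
exact: ole_trans (ole_osucc be).
Qed.

(** The stabilization stage moves up by one, so that every later stage is positive and has [al]
    strictly below it. *)
Lemma IN_Tr A : IN sat (Tr A) <-> IN sat A.
Proof.
split=> -[al inA]; first by exists al => be /(INat_valid inA).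
exists (osucc al) => be le_be n.
apply/(sat_Tr Hsat); first exact: olt_ole_trans (osucc_gt0 al) le_be.
exists al; split=> [|de le_de _]; first exact: olt_ole_trans (olt_osucc al) le_be.
exact: inA.
Qed.

Lemma stabilizes_all_pred be :
  stabilizes_all sat (osucc be) -> stabilizes_all sat be.
Proof.
(* [Tr A] is always a sentence, names being closed. Its behaviour at [osucc be] reflects that of [A]
   at [be]. *)
move=> stab A sA; have [stab1 stab2] := stab (Tr A) (fun=> isT).
have [stabA _] := stab A sA.
split=> [inA ga le_ga n|valA].
  (* The only new stage is [be] itself, where [Tr A] is read off from [Tr (Tr A)] at [osucc be]. *)
  have [le_be|/osucc_ole le_be] := ole_or_olt ga be; last exact: stabA.
  apply: (sat_ext Hsat le_ga le_be).
  have inTA : IN sat (Tr A) by apply/IN_Tr.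
  by apply/sat_Tr_osucc/stab1 => //; apply: ole_refl.
by apply/IN_Tr/stab2 => n; apply/sat_Tr_osucc.
Qed.

Lemma stabilizes_all_ext al be :
  ole al be -> ole be al -> stabilizes_all sat al -> stabilizes_all sat be.
Proof.
move=> le_ab le_ba stab A sA; have [stab1 stab2] := stab A sA.
split=> [/stab1 inA ga le_ga|valA]; first by apply: inA; apply: ole_trans le_ga.
by apply: stab2 => n; apply: sat_ext (valA n).
Qed.

(** Closure under successors holds vacuously for zero, so positivity is a separate matter. *)
Lemma varpi_limit varpi : is_varpi sat varpi ->
  forall al, olt al varpi -> olt (osucc al) varpi.
Proof.
move=> [stab least] al lt_al.
have [le_varpi|//] := ole_or_olt varpi (osucc al).
case: (@olt_irrefl al); apply: (olt_ole_trans lt_al).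
apply/least/stabilizes_all_pred.
exact: stabilizes_all_ext le_varpi (osucc_ole lt_al) stab.
Qed.

Definition cofinally (la : Ord) (n : nat) (A : formula) : Prop :=
  forall ga, olt ga la -> exists de, [/\ ole ga de, olt de la & sat de n A].

(** For [la] equal to [varpi], the conclusion is the instance at [n] of [thesis]. *)
Lemma cofinally_not_Tr_Neg la n A : olt ozero la ->
  cofinally la n A -> sat la n (Neg (Tr (Neg A))).
Proof.
move=> la_gt0 cofA; apply/sat_Neg => /(sat_Tr Hsat)[//|ga [lt_ga negA]].
have [de [le_de lt_de satA]] := cofA ga lt_ga.
by have /sat_Neg := negA de le_de lt_de.
Qed.

Section Limit.

Variables (la : Ord) (n : nat).
Hypothesis la_limit : forall al, olt al la -> olt (osucc al) la.

Lemma cofinally_step A B :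
  (forall de, sat de n A -> sat (osucc de) n B) ->
  cofinally la n A -> cofinally la n B.
Proof.
move=> AB cofA ga /cofA[de [le_de lt_de satA]]; exists (osucc de).
split; [exact: ole_trans (ole_osucc de) | exact: la_limit | exact: AB].
Qed.

Lemma cofinally_Tr A : cofinally la n A -> cofinally la n (Tr A).
Proof. by apply: cofinally_step => de; rewrite sat_Tr_osucc. Qed.

Lemma cofinally_Neg_Tr A : cofinally la n (Neg A) -> cofinally la n (Neg (Tr A)).
Proof. by apply: cofinally_step => de; rewrite !sat_Neg sat_Tr_osucc. Qed.

Lemma cofinally_Neg_Tr_Neg A :
  cofinally la n A -> cofinally la n (Neg (Tr (Neg A))).
Proof.
by apply: cofinally_step => de; rewrite sat_Neg sat_Tr_osucc sat_Neg => satA; apply.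
Qed.

(** Of the stages [ga] and [osucc ga], one satisfies [A] and the other [Neg A]. *)
Lemma cofinally_alternating A :
  (forall de, sat (osucc de) n A <-> ~ sat de n A) ->
  cofinally la n A /\ cofinally la n (Neg A).
Proof.
move=> flip.
split=> ga lt_ga; case: (classic (sat ga n A)) => satA.
- by exists ga; split=> //; apply: ole_refl.
- exists (osucc ga); split; [exact: ole_osucc | exact: la_limit | exact/flip].
- exists (osucc ga); split; [exact: ole_osucc | exact: la_limit |].
  by apply/sat_Neg => /flip.
- by exists ga; split; [exact: ole_refl | | apply/sat_Neg].
Qed.

End Limit.

Definition russell (x : nat) : term := Compr x (NotMem (Var x) (Var x)).

Lemma russell_alternating x de n :
  let L := NotMem (russell x) (russell x) in
  sat (osucc de) n L <-> ~ sat de n L.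
Proof.
move=> L; rewrite {1}/L /NotMem sat_Neg (sat_Compr Hsat); first last.
- by [].
- exact: osucc_gt0.
(* Putting [russell x] for [x] in its own defining formula gives back [L]. *)
by rewrite sat_Tr_osucc /= eqxx.
Qed.

End Stages.

Theorem theorem13p0p7 (sat : stages) (Hsat : librationist sat)
    (varpi : Ord) (Hvarpi : is_varpi sat varpi)
    (Hpos : olt ozero varpi) (x : nat) :
  let r := Compr x (NotMem (Var x) (Var x)) in
  let L := NotMem r r in
  thesis sat varpi L /\
  thesis sat varpi (Neg L) /\
  thesis sat varpi (Tr L) /\
  thesis sat varpi (Tr (Neg L)) /\
  thesis sat varpi (Neg (Tr (Neg L))) /\
  thesis sat varpi (Neg (Tr L)).
Proof.
move=> r L; have lim := varpi_limit Hsat Hvarpi.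
have cof n := cofinally_alternating Hsat lim
  (fun de => russell_alternating Hsat x de n).
(* Each thesis reduces to cofinality of its formula. [L] and [Neg L] are immediate; the other four
   follow by passing to successor stages. *)
do !split; move=> n; have [cofL cofNL] := cof n;
  apply: cofinally_not_Tr_Neg => //.
- exact: cofinally_Tr.
- exact: cofinally_Tr.
- exact: cofinally_Neg_Tr_Neg.
- exact: cofinally_Neg_Tr.
Qed.
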